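(* There exists an absolute constant $c > 0$ such that for every integer $d \ge 2$, the limits $\lim_{k \rightarrow \infty} \frac{g(k,d)}{k}$ and $\lim_{k \rightarrow \infty} \frac{h(k,d)}{k}$ exist and satisfy $$c \left(\frac{d}{\log d}\right)^{1/3} \le \lim_{k \rightarrow \infty} \frac{g(k,d)}{k} \le \lim_{k \rightarrow \infty} \frac{h(k,d)}{k} \le \frac{d}{2}+1.$$
   Context: All graphs are finite, simple and undirected. For a graph $G$, $rep(G)$ is the largest number of vertices of $G$ that all have the same degree in $G$, and $maxrep(G)$ is the number of vertices of $G$ whose degree equals the maximum degree of $G$. For integers $k \ge 1$ and $d \ge 0$: $g(k,d)$ is the least nonnegative integer such that every graph with maximum degree at most $d$ and more than $g(k,d)$ vertices has an induced subgraph $H$ with $rep(H) \ge k$; $h(k,d)$ is the least nonnegative integer such that every graph with maximum degree at most $d$ and more than $h(k,d)$ vertices has an induced subgraph $H$ with $maxrep(H) \ge k$ (degrees being taken in $H$). Both are at most $(k-1)(d+1)$, hence finite. $\log$ is the natural logarithm. *)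

(* Defs.v *)
From mathcomp Require Import all_boot boolp.

Set Implicit Arguments.
Unset Strict Implicit.
Unset Printing Implicit Defensive.

Record sgraph := SGraph {
  vertex :> finType;
  adj : rel vertex;
  adj_sym : symmetric adj;
  adj_irr : irreflexive adj }.

Definition deg (G : sgraph) (v : G) : nat := #|[set u | adj v u]|.

Definition maxdeg (G : sgraph) : nat := \max_(v : G) deg v.

Definition rep (G : sgraph) : nat :=
  \max_(v : G) #|[set u : G | deg u == deg v]|.

Definition maxrep (G : sgraph) : nat := #|[set v : G | deg v == maxdeg G]|.

Section Induced.
Variables (G : sgraph) (S : {set G}).

Definition induced_adj : rel {x : G | x \in S} :=
  fun x y => adj (val x) (val y).

Lemma induced_sym : symmetric induced_adj.
Proof. by move=> x y; apply: adj_sym. Qed.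

Lemma induced_irr : irreflexive induced_adj.
Proof. by move=> x; apply: adj_irr. Qed.

Definition induced : sgraph := SGraph induced_sym induced_irr.

End Induced.

Definition forces (f : sgraph -> nat) (k d m : nat) : Prop :=
  forall G : sgraph, (maxdeg G <= d)%N -> (m < #|G|)%N ->
    exists S : {set G}, (k <= f (induced S))%N.

Lemma indep_set (G : sgraph) (d k : nat) (S : {set G}) :
  (maxdeg G <= d)%N -> (k * d.+1 <= #|S| + d)%N ->
  exists I : {set G}, [/\ I \subset S, (k <= #|I|)%N
    & {in I &, forall x y, adj x y = false}].
Proof.
move=> dG; elim: k S => [|k IH] S hS.
  by exists set0; rewrite sub0set; split=> // x y; rewrite inE.
have [v vS] : exists v, v \in S.
  apply/set0Pn/negP => /eqP S0; move: hS.
  by rewrite S0 cards0 mulSn add0n addSn ltnNge leq_addr.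
set N := v |: [set u | adj v u].
have cN : (#|N| <= d.+1)%N.
  rewrite cardsU1 -add1n leq_add ?leq_b1 //.
  exact: leq_trans (leq_bigmax v) dG.
have [|I [IS kI indI]] := IH (S :\: N).
  rewrite -(leq_add2l d.+1) -mulSn; apply: leq_trans hS _.
  rewrite addnA leq_add2r -(cardsID N S) leq_add2r.
  by apply: leq_trans cN; rewrite subset_leq_card // subsetIr.
have nvI x : x \in I -> (x == v = false) * (adj v x = false).
  by move/(subsetP IS); rewrite !inE negb_or -andbA => /and3P[/negbTE-> /negbTE->].
exists (v |: I); split.
- by rewrite subUset sub1set vS (subset_trans IS) ?subsetDl.
- rewrite cardsU1; case: (boolP (v \in I)) => [vI|_]; last by rewrite add1n.
  by have [] := nvI v vI; rewrite eqxx.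
- move=> x y; rewrite !in_setU1.
  move=> /predU1P[->|xI] /predU1P[->|yI]; first exact: adj_irr.
  + by rewrite (nvI _ yI).
  + by rewrite adj_sym (nvI _ xI).
  + exact: indI.
Qed.

Lemma maxrep_le_rep (G : sgraph) : (maxrep G <= rep G)%N.
Proof.
rewrite /maxrep.
have [->|[v]] := set_0Vmem [set v : G | deg v == maxdeg G]; first by rewrite cards0.
rewrite inE => /eqP <-.
exact: (leq_bigmax (F := fun v : G => #|[set u : G | deg u == deg v]|) v).
Qed.

Lemma maxrep_forces (k d : nat) : forces maxrep k d (k.-1 * d.+1).
Proof.
move=> G dG ltG.
have [|I [_ kI indI]] := @indep_set G d k [set: G] dG.
  rewrite cardsT; case: k ltG => // k /= ltG.
  by rewrite mulSn addnC -addSnnS leq_add2r.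
exists I; apply: leq_trans kI _.
have deg0 (x : induced I) : deg x = 0%N.
  apply/eqP; rewrite cards_eq0; apply/eqP/setP=> y; rewrite !inE.
  exact: indI (valP x) (valP y).
rewrite /maxrep; have -> : maxdeg (induced I) = 0%N.
  by apply: big1 => x _; apply: deg0.
rewrite (eq_card (B := {: induced I})) ?card_sig //.
by move=> x; rewrite !inE deg0.
Qed.

Lemma rep_forces (k d : nat) : forces rep k d (k.-1 * d.+1).
Proof.
move=> G dG /(maxrep_forces dG)[S kS].
by exists S; apply: leq_trans (maxrep_le_rep _).
Qed.

Lemma ex_rep_forces (k d : nat) : exists m, `[< forces rep k d m >].
Proof. by exists (k.-1 * d.+1)%N; apply/asboolP/rep_forces. Qed.

Lemma ex_maxrep_forces (k d : nat) : exists m, `[< forces maxrep k d m >].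
Proof. by exists (k.-1 * d.+1)%N; apply/asboolP/maxrep_forces. Qed.

Definition g (k d : nat) : nat := ex_minn (ex_rep_forces k d).

Definition h (k d : nat) : nat := ex_minn (ex_maxrep_forces k d).

(* Main.v *)
(* Disjoint unions make k |-> g (k+1) d and k |-> h (k+1) d superadditive, so
   both limits exist and are suprema (Fekete).

   Upper bound.  Repeatedly delete a vertex of maximum degree, and let N_i be
   the number of vertices left once all degrees are at most i.  If no induced
   subgraph has more than K vertices of maximum degree, the degree sum at stage
   i is at most (i - 1) N_i + K, while counting deleted edges it is at least
   2 (i N_i - N_0 - ... - N_(i-1)).  Hence
   (i + 1) N_i <= 2 (N_0 + ... + N_(i-1)) + K, and so N_i <= (i / 2 + 1) K.

   Lower bound.  Join u, v < d independently with probability (u + v) / (2 d).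
   If 2t vertices of S have the same degree in S, choose among them A and B of
   size t with label sums at least t^2 apart: the degree sums over A and over B
   agree, although their expected difference is of order |S| t^2 / d.  By a
   Chernoff bound this has probability at most exp (- c |S| t^3 / d^2), which
   beats the number of triples (S, A, B) once t^3 is of order d^2 log d.  So
   some graph on d vertices has no 2t equal degrees in an induced subgraph. *)
From Pilot Require Import Defs.
From mathcomp Require Import all_boot zify.
From mathcomp Require boolp.

Set Implicit Arguments.
Unset Strict Implicit.
Unset Printing Implicit Defensive.

(** * Degrees in induced subgraphs *)

(** Working with vertices of [G] instead of the subtype keeps degrees for different [S]
    comparable. *)
Definition sdeg (G : sgraph) (S : {set G}) (v : G) : nat :=
  #|[set u in S | adj v u]|.

Lemma deg_induced (G : sgraph) (S : {set G}) (x : induced S) :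
  deg x = sdeg S (val x).
Proof.
rewrite /deg /sdeg -(card_imset _ val_inj); apply: eq_card => u.
rewrite [RHS]inE; apply/imsetP/andP => [[y] | [uS xu]].
  by rewrite inE => xy ->; split => //; apply: valP.
by exists (Sub u uS); rewrite // inE.
Qed.

Lemma card_induced (G : sgraph) (S : {set G}) (P : pred G) :
  #|[set x : induced S | P (val x)]| = #|[set v in S | P v]|.
Proof.
rewrite -(card_imset _ val_inj); apply: eq_card => u.
rewrite [RHS]inE; apply/imsetP/andP => [[y] | [uS Pu]].
  by rewrite inE => Py ->; split => //; apply: valP.
by exists (Sub u uS); rewrite // inE.
Qed.

Lemma maxdeg_induced (G : sgraph) (S : {set G}) :
  maxdeg (induced S) = \max_(v in S) sdeg S v.
Proof.
apply/eqP; rewrite eqn_leq; apply/andP; split.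
  by apply/bigmax_leqP => x _; rewrite deg_induced; apply/leq_bigmax_cond/valP.
apply/bigmax_leqP => v vS.
have := leq_bigmax (F := @deg (induced S)) (Sub v vS : induced S).
by rewrite deg_induced.
Qed.

Lemma maxrep_induced (G : sgraph) (S : {set G}) :
  maxrep (induced S) = #|[set v in S | sdeg S v == \max_(u in S) sdeg S u]|.
Proof.
rewrite /maxrep maxdeg_induced -card_induced; apply: eq_card => x.
by rewrite !inE deg_induced.
Qed.

(** A value [D] that is not attained gives an empty class, so [D] may range over all naturals; this
    lets one [D] be used on both sides of a disjoint union. *)
Lemma rep_inducedP (G : sgraph) (S : {set G}) (k : nat) :
  reflect (forall D, #|[set v in S | sdeg S v == D]| <= k)%N
    (rep (induced S) <= k)%N.
Proof.
apply: (iffP (bigmax_leqP _ _ _)) => [H D | H x _].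
  have [->|[v]] := set_0Vmem [set v in S | sdeg S v == D].
    by rewrite cards0.
  rewrite inE => /andP[vS /eqP <-].
  have := H (Sub v vS : induced S) isT; apply: leq_trans.
  rewrite -card_induced; apply/eq_leq/eq_card => x.
  by rewrite !inE !deg_induced.
have := H (deg x); apply: leq_trans.
rewrite -card_induced; apply/eq_leq/eq_card => y.
by rewrite !inE !deg_induced.
Qed.

(** * Disjoint unions *)

Section DisjointUnion.
Variables G1 G2 : sgraph.

Definition dunion_adj : rel (G1 + G2)%type := fun x y =>
  match x, y with
  | inl u, inl v => adj u v
  | inr u, inr v => adj u v
  | _, _ => false
  end.

Lemma dunion_sym : symmetric dunion_adj.
Proof. by move=> [u|u] [v|v] //=; apply: adj_sym. Qed.

Lemma dunion_irr : irreflexive dunion_adj.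
Proof. by move=> [u|u] /=; apply: adj_irr. Qed.

Definition dunion : sgraph := SGraph dunion_sym dunion_irr.

Variable S : {set dunion}.
Let S1 : {set G1} := [set u | inl u \in S].
Let S2 : {set G2} := [set u | inr u \in S].

Lemma card_dunion (P : pred dunion) :
  #|[set x in S | P x]| =
  (#|[set u in S1 | P (inl u)]| + #|[set u in S2 | P (inr u)]|)%N.
Proof.
rewrite -!sum1_card (eq_bigl (fun x => (x \in S) && P x)); last first.
  by move=> x; rewrite inE.
rewrite big_sumType /=.
by congr addn; apply: eq_bigl => u; rewrite !inE.
Qed.

Lemma sdeg_inl (u : G1) : @sdeg dunion S (inl u) = sdeg S1 u.
Proof.
rewrite /sdeg card_dunion /= [X in (_ + X)%N]eq_card0 ?addn0 // => x.
by rewrite !inE andbF.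
Qed.

Lemma sdeg_inr (u : G2) : @sdeg dunion S (inr u) = sdeg S2 u.
Proof.
rewrite /sdeg card_dunion /= [X in (X + _)%N]eq_card0 ?add0n // => x.
by rewrite !inE andbF.
Qed.

Lemma rep_dunion :
  (rep (induced S) <= rep (induced S1) + rep (induced S2))%N.
Proof.
apply/rep_inducedP => D; rewrite card_dunion.
apply: leq_add.
  have /rep_inducedP/(_ D) := leqnn (rep (induced S1)); apply: leq_trans.
  by apply/eq_leq/eq_card => x; rewrite !inE sdeg_inl.
have /rep_inducedP/(_ D) := leqnn (rep (induced S2)); apply: leq_trans.
by apply/eq_leq/eq_card => x; rewrite !inE sdeg_inr.
Qed.

(** On each side the maximum [M] of the union is either not attained, and that side contributes
    nothing, or it is that side's own maximum. *)
Lemma maxrep_dunion :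
  (maxrep (induced S) <= maxrep (induced S1) + maxrep (induced S2))%N.
Proof.
rewrite !maxrep_induced card_dunion.
set M := (\max_(u in S) _)%N.
have M1 u : u \in S1 -> (sdeg S1 u <= M)%N.
  by rewrite inE => uS; rewrite -sdeg_inl; apply: leq_bigmax_cond.
have M2 u : u \in S2 -> (sdeg S2 u <= M)%N.
  by rewrite inE => uS; rewrite -sdeg_inr; apply: leq_bigmax_cond.
apply: leq_add; apply/subset_leq_card/subsetP => u; rewrite !in_set.
  rewrite sdeg_inl => /andP[uS /eqP uM]; rewrite uS eqn_leq.
  rewrite (leq_bigmax_cond (F := sdeg S1)) ?inE //= uM.
  by apply/bigmax_leqP => v /M1.
rewrite sdeg_inr => /andP[uS /eqP uM]; rewrite uS eqn_leq.
rewrite (leq_bigmax_cond (F := sdeg S2)) ?inE //= uM.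
by apply/bigmax_leqP => v /M2.
Qed.

End DisjointUnion.

Lemma maxdeg_dunion (G1 G2 : sgraph) :
  maxdeg (dunion G1 G2) = maxn (maxdeg G1) (maxdeg G2).
Proof.
have E (G : sgraph) (v : G) : deg v = sdeg [set: G] v.
  by apply: eq_card => u; rewrite !inE.
rewrite /maxdeg big_sumType /=; congr maxn; apply: eq_bigr => u _.
  by rewrite !E sdeg_inl; apply: eq_card => v; rewrite !inE.
by rewrite !E sdeg_inr; apply: eq_card => v; rewrite !inE.
Qed.

(** * The upper bound by deleting vertices of maximum degree *)

Section Upper.
Variables (G : sgraph) (K : nat).
Hypothesis maxrepG : forall S : {set G}, (maxrep (induced S) <= K)%N.

Let degsum (W : {set G}) := (\sum_(v in W) sdeg W v)%N.

(** If the value [i] is attained it is the maximum degree, so at most [K] vertices have it and all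
    others have degree at most [i - 1]. Placing [#|W|] on the left avoids the truncated [i - 1]. *)
Lemma degsum_le (W : {set G}) i : {in W, forall v, sdeg W v <= i}%N ->
  (degsum W + #|W| <= i * #|W| + K)%N.
Proof.
move=> Wi; have [v /andP[vW /eqP vi]|noi] :=
  pickP [pred v | (v \in W) && (sdeg W v == i)].
  have maxi : (\max_(u in W) sdeg W u)%N = i.
    apply/eqP; rewrite eqn_leq -{2}vi leq_bigmax_cond // andbT.
    exact/bigmax_leqP.
  have := maxrepG W; rewrite maxrep_induced maxi => KW.
  apply: (@leq_trans (i * #|W| + #|[set v in W | sdeg W v == i]|)); last first.
    by rewrite leq_add2l.
  rewrite mulnC -sum1dep_card big_mkcondr /= -sum_nat_const -sum1_card.
  rewrite -!big_split /=; apply: leq_sum => u uW.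
  by have := Wi u uW; case: eqP => //; lia.
suff: (degsum W + #|W| <= i * #|W|)%N by lia.
rewrite mulnC -sum_nat_const -sum1_card -big_split /=; apply: leq_sum => u uW.
have := Wi u uW; rewrite leq_eqVlt; have /= := noi u.
by rewrite uW /= => ->; lia.
Qed.

Lemma degsum_remove (W : {set G}) v : v \in W ->
  (degsum (W :\ v) + 2 * sdeg W v = degsum W)%N.
Proof.
move=> vW; rewrite /degsum [RHS](big_setD1 v vW) /=.
have -> : (\sum_(u in W :\ v) sdeg W u =
  \sum_(u in W :\ v) (sdeg (W :\ v) u + adj v u))%N.
  apply: eq_bigr => u _; rewrite /sdeg (cardsD1 v) inE vW adj_sym addnC.
  by congr (_ + _)%N; apply: eq_card => x; rewrite !inE andbA.
rewrite big_split /= -[X in (_ = _ + (_ + X))%N]big_mkcondr /=.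
suff -> : sdeg W v = (\sum_(u in W :\ v | adj v u) 1)%N by lia.
rewrite sum1_card; apply: eq_card => u; rewrite !inE [in RHS]unfold_in /= !inE.
by have [->|] := eqVneq; rewrite //= adj_irr andbF.
Qed.

Lemma sdegS (A B : {set G}) v : A \subset B -> (sdeg A v <= sdeg B v)%N.
Proof.
move=> AB; apply/subset_leq_card/subsetP => u.
by rewrite !inE => /andP[/(subsetP AB)->].
Qed.

(** Eliminating [degsum W] with [degsum_le] leaves [2 (i + 1) |W| <= (i + 1) (i + 2) K], from which
    [i + 1] cancels. *)
Lemma card_le_of_degsum i (W : {set G}) : {in W, forall v, sdeg W v <= i}%N ->
  (4 * i * #|W| <= 2 * degsum W + K * (i * (i + 3)))%N ->
  (2 * #|W| <= (i + 2) * K)%N.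
Proof.
move=> /degsum_le; move: (degsum W) #|W| => D w H1 H2.
by rewrite -(leq_pmul2l (ltn0Sn i)); nia.
Qed.

(* The constant comes from greedily deleting vertices of maximum degree: if N_j
   vertices are left once all degrees are at most j, then
   degsum W >= 2 (i |W| - sum_(j < i) N_j), and 2 N_j <= (j + 2) K by induction. *)
Lemma degsum_ge i (W : {set G}) : {in W, forall v, sdeg W v <= i}%N ->
  (4 * i * #|W| <= 2 * degsum W + K * (i * (i + 3)))%N.
Proof.
elim: i W => [|i IHi] W; first by rewrite muln0 mul0n.
have [n] := ubnP #|W|; elim: n W => // n IHn W Wn Wi.
have [v /andP[vW /eqP vi]|noi] :=
  pickP [pred v | (v \in W) && (sdeg W v == i.+1)].
  have cW := cardsD1 v W; rewrite vW in cW.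
  have := degsum_remove vW; rewrite vi => <-.
  (* Deleting [v] lowers [2 * degsum] and the left-hand side by the same amount, [4 (i + 1)]. *)
  have : (4 * i.+1 * #|W :\ v| <=
          2 * degsum (W :\ v) + K * (i.+1 * (i.+1 + 3)))%N.
    apply: IHn => [|u]; first by lia.
    rewrite inE => /andP[_ uW]; apply: leq_trans (Wi u uW).
    exact/sdegS/subD1set.
  by lia.
have {}Wi : {in W, forall v, sdeg W v <= i}%N.
  move=> v vW; have := Wi v vW; rewrite leq_eqVlt; have /= := noi v.
  by rewrite vW /= => ->.
(* From [i] to [i + 1] the left side gains [4 |W| <= 2 (i + 2) K], which is exactly the increment of
   [K i (i + 3)]. *)
have H := IHi W Wi; have := card_le_of_degsum Wi H; nia.
Qed.

Lemma card_le_maxrep d : (maxdeg G <= d)%N -> (2 * #|G| <= (d + 2) * K)%N.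
Proof.
move=> Gd; have Wd : {in [set: G], forall v, sdeg [set: G] v <= d}%N.
  move=> v _; apply: leq_trans Gd; rewrite /maxdeg.
  apply: leq_trans (leq_bigmax v); apply/eq_leq/eq_card => u.
  by rewrite !inE.
by have := card_le_of_degsum Wd (degsum_ge Wd); rewrite cardsT.
Qed.

End Upper.

(** * Extremal graphs and superadditivity, for [g] and [h] at once *)

Section Threshold.
Variables (f : sgraph -> nat) (d : nat).
Hypothesis forces_ex : forall k, exists m, boolp.asbool (forces f k d m).

Let F k := ex_minn (forces_ex k).

Definition avoids k (G : sgraph) :=
  (maxdeg G <= d)%N /\ forall S : {set G}, (f (induced S) < k)%N.

Lemma card_le_threshold k G : avoids k G -> (#|G| <= F k)%N.
Proof.
case=> Gd Gk; rewrite /F; case: ex_minnP => m /boolp.asboolP mP _.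
by rewrite leqNgt; apply/negP => /(mP G Gd)[S]; rewrite leqNgt Gk.
Qed.

Hypothesis f_card : forall G : sgraph, (f G <= #|G|)%N.
Hypothesis f_dunion : forall (G1 G2 : sgraph) (S : {set dunion G1 G2}),
  (f (induced S) <= f (induced [set u | inl u \in S])
                    + f (induced [set u | inr u \in S]))%N.

(** By minimality the predecessor of the threshold does not force, and a counterexample to it is
    extremal. Threshold 0 has no predecessor; there the empty graph serves. *)
Lemma threshold_extremal k : exists2 G, avoids k.+1 G & (F k.+1 <= #|G|)%N.
Proof.
rewrite /F; case: ex_minnP => [[_ _|m _ min_m]].
  pose G := @SGraph void (fun _ _ => false) (fun _ _ => erefl) (fun _ => erefl).
  exists G => //; split=> [|S]; first by apply/bigmax_leqP => -[].
  rewrite ltnS; apply: leq_trans (f_card _) _.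
  by rewrite eq_card0 // => -[[]].
apply: boolp.contrapT => noG.
suff /boolp.asboolP/min_m : forces f k.+1 d m by rewrite ltnn.
move=> G Gd mG; apply: boolp.contrapT => noS; apply: noG; exists G => //.
by split=> // S; rewrite ltnNge; apply/negP => kS; apply: noS; exists S.
Qed.

(** Avoiding [k.+1] means that [f] is at most [k] on induced subgraphs; these bounds add under
    disjoint union, hence the shifted indices. *)
Lemma threshold_superadd a b : (F a.+1 + F b.+1 <= F (a + b).+1)%N.
Proof.
have [G1 [G1d G1a] le1] := threshold_extremal a.
have [G2 [G2d G2b] le2] := threshold_extremal b.
apply: (leq_trans (leq_add le1 le2)); rewrite -card_sum.
apply: (@card_le_threshold _ (dunion G1 G2)); split=> [|S].
  by rewrite maxdeg_dunion geq_max G1d.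
by rewrite ltnS (leq_trans (f_dunion S)) // leq_add // -ltnS.
Qed.

End Threshold.

Lemma maxrep_card (G : sgraph) : (maxrep G <= #|G|)%N.
Proof. exact: max_card. Qed.

Lemma rep_card (G : sgraph) : (rep G <= #|G|)%N.
Proof. by apply/bigmax_leqP => v _; apply: max_card. Qed.

Lemma g_superadd d a b : (g a.+1 d + g b.+1 d <= g (a + b).+1 d)%N.
Proof. exact: threshold_superadd (ex_rep_forces^~ d) rep_card rep_dunion a b. Qed.

Lemma h_superadd d a b : (h a.+1 d + h b.+1 d <= h (a + b).+1 d)%N.
Proof.
exact: threshold_superadd (ex_maxrep_forces^~ d) maxrep_card maxrep_dunion a b.
Qed.

Lemma g_le_h k d : (g k d <= h k d)%N.
Proof.
rewrite /g; case: ex_minnP => m _; apply; rewrite /h.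
case: ex_minnP => n /boolp.asboolP nP _; apply/boolp.asboolP => G Gd /(nP G Gd)[S kS].
by exists S; apply: leq_trans kS (maxrep_le_rep _).
Qed.

Lemma h_le k d : (2 * h k.+1 d <= (d + 2) * k)%N.
Proof.
have [G [Gd Gk] hG] := threshold_extremal (ex_maxrep_forces^~ d) maxrep_card k.
by apply: leq_trans (card_le_maxrep Gk Gd); rewrite leq_mul2l.
Qed.

(** * Two label sets with far apart sums *)

(* Peeling off the largest and the smallest of at least 2t labels gains at
   least 2t - 1, and 1 + 3 + ... + (2t - 1) = t^2. *)
Lemma sum_gap n t (T : {set 'I_n}) : (2 * t <= #|T|)%N ->
  exists A B : {set 'I_n}, [/\ A \subset T, B \subset T, [disjoint A & B],
    #|A| = t & #|B| = t /\ (\sum_(i in B) i + t ^ 2 <= \sum_(i in A) i)%N].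
Proof.
elim: t T => [|t IHt] T tT.
  exists set0, set0; split; rewrite ?sub0set ?cards0 ?big_set0 //.
  by rewrite -setI_eq0 set0I.
have [x0 x0T] : exists x, x \in T by apply/card_gt0P; lia.
case: (@arg_maxnP _ x0 (mem T) val x0T) => M MT maxM.
case: (@arg_minnP _ x0 (mem T) val x0T) => m mT minm.
have {}MT : M \in T by [].
have {}mT : m \in T by [].
(* The labels in [T] are distinct and lie between [m] and [M]. *)
have gap : (#|T| <= (M - m).+1)%N.
  rewrite cardE -(size_map val) -(size_iota m (M - m).+1).
  apply: uniq_leq_size.
    by rewrite map_inj_uniq ?enum_uniq //; apply: val_inj.
  move=> x /mapP[i]; rewrite mem_enum => iT ->; rewrite mem_iota.
  by have := maxM i iT; have := minm i iT; rewrite /=; lia.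
have Mm : M != m by apply/eqP => Mm; move: gap; rewrite Mm; lia.
have [|A [B [AT BT AB [cA [cB AB2]]]]] := IHt (T :\: [set M; m]).
  rewrite -(leq_add2l #|T :&: [set M; m]|) cardsID; apply: leq_trans tT.
  rewrite mulnS leq_add2r; apply: leq_trans (subset_leq_card (subsetIr _ _)) _.
  by rewrite cards2 Mm.
have nA x : x \in A -> (x != M) && (x != m).
  by move/(subsetP AT); rewrite !inE negb_or => /andP[].
have nB x : x \in B -> (x != M) && (x != m).
  by move/(subsetP BT); rewrite !inE negb_or => /andP[].
have MA : M \notin A by apply/negP => /nA; rewrite eqxx.
have mA : m \notin A by apply/negP => /nA; rewrite eqxx andbF.
have MB : M \notin B by apply/negP => /nB; rewrite eqxx.
have mB : m \notin B by apply/negP => /nB; rewrite eqxx andbF.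
exists (M |: A), (m |: B); split; [| | |by rewrite cardsU1 MA cA|split].
- by rewrite subUset sub1set MT (subset_trans AT) ?subsetDl.
- by rewrite subUset sub1set mT (subset_trans BT) ?subsetDl.
- rewrite -setI_eq0; apply/eqP/setP => x; rewrite !inE.
  have [->|_] /= := eqVneq x M; first by rewrite (negbTE Mm) (negbTE MB).
  have [->|_] /= := eqVneq x m; first by rewrite (negbTE mA).
  by apply: contraTF AB => /andP[xA xB]; apply/pred0Pn; exists x; apply/andP.
- by rewrite cardsU1 mB cB.
- have tMm := leq_trans tT gap; rewrite !big_setU1 //=.
  move: AB2 tMm; rewrite -!mulnn.
  move: (\sum_(i in B) i)%N (\sum_(i in A) i)%N (M : nat) (m : nat) => a b p q.
  by nia.
Qed.

From mathcomp Require Import all_order all_algebra.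
From mathcomp Require Import all_classical all_reals all_analysis.
From mathcomp Require Import ring lra.
Import Order.TTheory GRing.Theory Num.Theory.
Import numFieldNormedType.Exports.
(* [all_analysis] shadows [induced]. *)
Import Pilot.Defs.
Local Open Scope ring_scope.

(** * Exponential moments of independent bits *)

Section MomentGeneratingFunction.
Variable R : realType.

(** [exp x <= 1 / (1 - x)], and [(1 - x) (1 + x + 2 x^2) = 1 + x^2 (1 - 2 x) >= 1]. *)
Lemma expR_le_quad (x : R) : x <= 2^-1 -> expR x <= 1 + x + 2 * x ^+ 2.
Proof.
move=> x2; have x1 : 0 < 1 - x by lra.
have : 1 - x <= expR (- x) by have := expR_ge1Dx (- x).
rewrite expRN => h.
apply: le_trans (_ : (1 - x)^-1 <= _).
  by rewrite -[expR x]invrK lef_pV2 ?posrE // invr_gt0 expR_gt0.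
rewrite -[(1 - x)^-1]mul1r ler_pdivrMr //.
have : 0 <= x ^+ 2 * (1 - 2 * x) by rewrite mulr_ge0 ?sqr_ge0 //; lra.
nra.
Qed.

Definition bern (p : R) (b : bool) : R := if b then p else 1 - p.

Variables (E : finType) (p : E -> R).
Hypothesis p01 : forall e, 0 <= p e <= 1.

Definition weight (w : {ffun E -> bool}) : R := \prod_e bern (p e) (w e).

Lemma weight_ge0 w : 0 <= weight w.
Proof.
apply: prodr_ge0 => e _; rewrite /bern; have /andP[] := p01 e.
by case: (w e) => //; lra.
Qed.

Lemma sum_weight : \sum_w weight w = 1.
Proof.
rewrite -(bigA_distr_bigA (fun e => bern (p e))) big1 // => e _.
by rewrite big_bool /bern /= addrC subrK.
Qed.

(** After centring by [exp (c q)] the linear terms cancel, and the quadratic ones sum to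
    [2 c^2 q (1 - q) <= c^2]. *)
Lemma bernoulli_mgf (q c : R) : 0 <= q <= 1 -> `|c| <= 2^-1 ->
  \sum_(b : bool) bern q b * expR (c * b%:R) <= expR (c * q + c ^+ 2).
Proof.
move=> /andP[q0 q1]; rewrite ler_norml => /andP[c1 c2].
rewrite expRD -ler_pdivrMl ?expR_gt0 // -expRN mulr_sumr.
rewrite big_bool /bern /= mulr1 mulr0 expR0 mulr1 mulrCA -expRD.
rewrite [expR _ * (1 - q)]mulrC.
have E1 : expR (- (c * q) + c) <= 1 + (- (c * q) + c) + 2 * (- (c * q) + c) ^+ 2.
  by apply: expR_le_quad; nra.
have E0 : expR (- (c * q)) <= 1 + (- (c * q)) + 2 * (- (c * q)) ^+ 2.
  by apply: expR_le_quad; nra.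
apply: le_trans (expR_ge1Dx _).
have q1' : 0 <= 1 - q by lra.
apply: le_trans (lerD (ler_wpM2l q0 E1) (ler_wpM2l q1' E0)) _.
have -> : q * (1 + (- (c * q) + c) + 2 * (- (c * q) + c) ^+ 2) +
   (1 - q) * (1 - c * q + 2 * (- (c * q)) ^+ 2) =
   1 + 2 * c ^+ 2 * (q * (1 - q)) by ring.
have : 2 * (q * (1 - q)) <= 1 by nra.
by have := sqr_ge0 c; nra.
Qed.

Lemma weight_mgf (c : E -> R) : (forall e, `|c e| <= 2^-1) ->
  \sum_w weight w * expR (\sum_e c e * (w e)%:R) <=
  expR (\sum_e c e * p e + \sum_e c e ^+ 2).
Proof.
move=> c2; rewrite -big_split /= expR_sum.
rewrite [leLHS](_ : _ = \sum_(w : {ffun E -> bool})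
    \prod_e (bern (p e) (w e) * expR (c e * (w e)%:R))); last first.
  by apply: eq_bigr => w _; rewrite expR_sum -big_split.
rewrite -(bigA_distr_bigA (fun e b => bern (p e) b * expR (c e * b%:R))).
apply: ler_prod => e _; rewrite bernoulli_mgf // andbT.
apply: sumr_ge0 => b _; rewrite mulr_ge0 ?expR_ge0 // /bern.
by have /andP[] := p01 e; case: b => //; lra.
Qed.

End MomentGeneratingFunction.

(** * The random graph and its degree differences *)

Section RandomGraph.
Variable n : nat.
Implicit Types (w : {ffun 'I_n * 'I_n -> bool}) (S A B : {set 'I_n}).

(** Each edge is read from the bit of its increasing pair, so the relation is symmetric and distinct
    edges are independent. *)
Definition radj w : rel 'I_n := fun u v =>
  (u < v)%N && w (u, v) || (v < u)%N && w (v, u).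

Lemma radj_sym w : symmetric (radj w).
Proof. by move=> u v; rewrite /radj orbC. Qed.

Lemma radj_irr w : irreflexive (radj w).
Proof. by move=> u; rewrite /radj ltnn. Qed.

Definition bitgraph w : sgraph := SGraph (radj_sym w) (radj_irr w).

Lemma maxdeg_bitgraph w : (maxdeg (bitgraph w) <= n)%N.
Proof.
by apply/bigmax_leqP => v _; apply: leq_trans (max_card _) _; rewrite card_ord.
Qed.

Variable R : realType.

(** Double counting: each unordered pair is seen once from either end. This turns sums over edges
    into sums over vertices. *)
Lemma sum_sym (f : 'I_n -> R) (s : 'I_n -> 'I_n -> R) :
  (forall u v, s u v = s v u) -> (forall v, s v v = 0) ->
  \sum_(e : 'I_n * 'I_n | (e.1 < e.2)%N) (f e.1 + f e.2) * s e.1 e.2 =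
  \sum_v f v * \sum_u s v u.
Proof.
move=> ssym sirr.
rewrite -(pair_big_dep xpredT (fun u v : 'I_n => (u < v)%N)
  (fun u v => (f u + f v) * s u v)) /=.
under eq_bigr do under eq_bigr do rewrite mulrDl.
under eq_bigr do rewrite big_split /=.
rewrite big_split /= [X in _ + X](exchange_big_dep xpredT) //= -big_split /=.
apply: eq_bigr => v _; rewrite mulr_sumr [RHS](bigID (fun u : 'I_n => (v < u)%N)) /=.
congr (_ + _); rewrite [RHS](bigD1 v) ?ltnn //= sirr mulr0 add0r.
apply: eq_big => [u|u _]; last by rewrite ssym.
by rewrite -leqNgt ltn_neqAle andbC.
Qed.

Definition sgn A B v : R := (v \in A)%:R - (v \in B)%:R.

(* [\sum_e coef S A B e * (w e)%:R] is the sum of the degrees in [S] of the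
   vertices of [A] minus the same sum over [B]. *)
Definition coef S A B (e : 'I_n * 'I_n) : R :=
  if (e.1 < e.2)%N then
    (sgn A B e.1 + sgn A B e.2) * ((e.1 \in S) && (e.2 \in S))%:R
  else 0.

(** Stated for any symmetric [s'] with zero diagonal, so that it serves both the actual edges and
    the edge probabilities. *)
Lemma sum_coef S A B (s : 'I_n * 'I_n -> R) (s' : 'I_n -> 'I_n -> R) :
  A \subset S -> B \subset S ->
  (forall u v, s' u v = s' v u) -> (forall v, s' v v = 0) ->
  (forall u v : 'I_n, (u < v)%N -> s (u, v) = s' u v) ->
  \sum_e coef S A B e * s e = \sum_v sgn A B v * \sum_(u in S) s' v u.
Proof.
move=> AS BS ssym sirr ss'.
pose s1 u v := ((u \in S) && (v \in S))%:R * s' u v.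
have -> : \sum_v sgn A B v * \sum_(u in S) s' v u =
    \sum_v sgn A B v * \sum_u s1 v u.
  apply: eq_bigr => v _; have [vS|vS] := boolP (v \in S).
    congr (_ * _); rewrite big_mkcond /=; apply: eq_bigr => u _.
    by rewrite /s1 vS /=; case: (u \in S); rewrite ?mul1r ?mul0r.
  suff -> : sgn A B v = 0 by rewrite !mul0r.
  rewrite /sgn (contraNF (fintype.subsetP AS v) vS).
  by rewrite (contraNF (fintype.subsetP BS v) vS) subrr.
rewrite -sum_sym; last 2 first.
- by move=> u v; rewrite /s1 andbC ssym.
- by move=> v; rewrite /s1 sirr mulr0.
rewrite [RHS]big_mkcond; apply: eq_bigr => -[u v] _; rewrite /coef /=.
by case: ifP => uv; rewrite ?mul0r // /s1 ss' // mulrA.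
Qed.

(* Edge probabilities increase with the labels, which spreads the expected
   degrees in every induced subgraph. *)
Definition prob (e : 'I_n * 'I_n) : R := (e.1 + e.2)%:R / (2 * n)%:R.

Lemma prob01 e : 0 <= prob e <= 1.
Proof.
have n0 : (0 < n)%N by case: e => -[i ltin] _; case: n ltin.
rewrite /prob divr_ge0 //= ler_pdivrMr ?ltr0n ?muln_gt0 // mul1r ler_nat.
by have := ltn_ord e.1; have := ltn_ord e.2; lia.
Qed.

Section Balanced.
Variables (S A B : {set 'I_n}) (t : nat).
Hypotheses (AS : A \subset S) (BS : B \subset S) (AB : [disjoint A & B])
  (cA : #|A| = t) (cB : #|B| = t)
  (gap : (\sum_(i in B) i + t ^ 2 <= \sum_(i in A) i)%N).

Lemma sum_sgn (f : 'I_n -> R) :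
  \sum_v sgn A B v * f v = \sum_(v in A) f v - \sum_(v in B) f v.
Proof.
rewrite [in RHS]big_mkcond [X in _ - X]big_mkcond -sumrB /=.
apply: eq_bigr => v _; rewrite /sgn.
by case: (v \in A); case: (v \in B); rewrite ?subrr ?subr0 ?sub0r ?mul0r ?mul1r ?mulN1r.
Qed.

Lemma sum_sgn_sqr : \sum_v sgn A B v ^+ 2 = (2 * t)%:R.
Proof.
under eq_bigr do rewrite expr2.
rewrite sum_sgn /sgn mul2n -addnn natrD.
rewrite -[in X in X%:R + _]cA -[in X in _ + X%:R]cB -!sum1_card !natr_sum -sumrN.
congr (_ + _); apply: eq_bigr => v vAB; rewrite vAB.
  by rewrite (disjointFr AB vAB) subr0.
by rewrite (disjointFl AB vAB) sub0r opprK.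
Qed.

Lemma normr_coef e : `|coef S A B e| <= 2.
Proof.
rewrite /coef; case: ifP => _; last by rewrite normr0.
rewrite normrM (@le_trans _ _ (`|sgn A B e.1 + sgn A B e.2| * 1)) //.
  by rewrite ler_wpM2l // ger0_norm // lern1 leq_b1.
rewrite mulr1 (le_trans (ler_normD _ _)) // -[2]/(1 + 1) lerD // /sgn;
  by case: (_ \in A); case: (_ \in B); rewrite ?subrr ?subr0 ?sub0r ?normrN ?normr1 ?normr0.
Qed.

(** By [(x + y)^2 <= 2 (x^2 + y^2)] and [sum_sym], each of the [2 t] vertices of [A] and [B]
    contributes at most [2 |S|]. *)
Lemma sum_coef_sqr : \sum_e coef S A B e ^+ 2 <= (4 * t * #|S|)%:R.
Proof.
pose s u v : R := ((u != v) && ((u \in S) && (v \in S)))%:R * 2.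
apply: le_trans (_ : \sum_v sgn A B v ^+ 2 * \sum_u s v u <= _).
  rewrite -sum_sym; last 2 first.
  - by move=> u v; rewrite /s eq_sym [(u \in S) && _]andbC.
  - by move=> v; rewrite /s eqxx mul0r.
  rewrite [leRHS]big_mkcond; apply: ler_sum => -[u v] _; rewrite /coef /s /=.
  case: ifP => [uv|_]; last by rewrite expr0n.
  have -> : u != v by apply: contraTneq uv => ->; rewrite ltnn.
  case: (_ && _); rewrite /= ?mulr1 ?mul0r ?mulr0 ?expr0n // mul1r.
  by have := sqr_ge0 (sgn A B u - sgn A B v); nra.
apply: le_trans (_ : \sum_v sgn A B v ^+ 2 * (2 * #|S|)%:R <= _).
  apply: ler_sum => v _; rewrite ler_wpM2l ?sqr_ge0 //.
  rewrite /s -mulr_suml mulrC natrM ler_wpM2l // -natr_sum ler_nat.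
  rewrite -sum1_card [leqRHS]big_mkcond /=; apply: leq_sum => u _.
  by case: (u \in S); rewrite ?leq_b1 // !andbF.
by rewrite -mulr_suml sum_sgn_sqr -natrM ler_nat mulnACA mulnA.
Qed.

Lemma sum_coef_adj w D :
  (forall v : 'I_n, v \in A :|: B -> sdeg (S : {set bitgraph w}) v = D) ->
  \sum_e coef S A B e * (w e)%:R = 0.
Proof.
move=> wD; rewrite (@sum_coef _ _ _ _ (fun u v => (radj w u v)%:R)) //.
- have E v : \sum_(u in S) (radj w v u)%:R = (sdeg (S : {set bitgraph w}) v)%:R :> R.
    rewrite -natr_sum /sdeg -sum1dep_card big_mkcondr.
    by congr (_%:R); apply: eq_bigr => u _ /=; case: (radj w v u).
  under eq_bigr do rewrite E.
  rewrite sum_sgn (eq_bigr (fun=> D%:R)) => [|v vA]; last first.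
    by rewrite wD // inE vA.
  rewrite [X in _ - X](eq_bigr (fun=> D%:R)) => [|v vB]; last first.
    by rewrite wD // inE vB orbT.
  by rewrite !sumr_const cA cB subrr.
- by move=> u v; rewrite radj_sym.
- by move=> v; rewrite radj_irr.
- by move=> u v uv; rewrite /radj uv [(v < u)%N]ltnNge (ltnW uv) orbF.
Qed.

(** The expected degree of [v] in [S] is affine in its label with slope [(|S| - 2) / (2 n)]: the
    label occurs in [|S| - 1] pairs, and is missing once from the sum over the other vertices. *)
Lemma sum_coef_prob : (2 <= #|S|)%N ->
  ((#|S| - 2) * t ^ 2)%:R / (2 * n)%:R <= \sum_e coef S A B e * prob e.
Proof.
move=> S2.
rewrite (@sum_coef _ _ _ _ (fun u v => (u != v)%:R * prob (u, v))) //; last 3 first.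
- by move=> u v; rewrite eq_sym /prob /= addnC.
- by move=> v; rewrite eqxx mul0r.
- move=> u v uv; have -> : u != v by apply: contraTneq uv => ->; rewrite ltnn.
  by rewrite mul1r.
have E v : v \in S -> \sum_(u in S) (v != u)%:R * prob (v, u) =
    (\sum_(u in S) u + (#|S| - 2) * v)%:R / (2 * n)%:R.
  move=> vS; rewrite (bigD1 v vS) /= eqxx mul0r add0r.
  rewrite (eq_bigr (fun u => prob (v, u))) => [|u /andP[_ uv]]; last first.
    by rewrite eq_sym uv mul1r.
  rewrite -mulr_suml -natr_sum; congr (_%:R / _).
  apply: (@addnI (v + v)%N); rewrite -[LHS](bigD1 v vS (F := fun u => (v + u)%N)) /=.
  rewrite big_split /= sum_nat_const addnC [RHS]addnCA; congr (_ + _)%N.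
  by rewrite addnn -mul2n -mulnDl subnKC.
rewrite sum_sgn (eq_bigr _ (fun v vA => E v (fintype.subsetP AS v vA))).
rewrite [X in _ - X](eq_bigr _ (fun v vB => E v (fintype.subsetP BS v vB))).
rewrite -!mulr_suml -mulrBl ler_wpM2r ?invr_ge0 // -!natr_sum lerBrDr -natrD ler_nat.
rewrite !big_split /= !sum_nat_const cA cB -!big_distrr /=.
by rewrite addnCA leq_add2l -mulnDr leq_mul2l addnC gap orbT.
Qed.

End Balanced.

End RandomGraph.

(** * The union bound over triples [S], [A], [B] *)

Section UnionBound.
Variables (R : realType) (n t : nat).
Hypotheses (n0 : (0 < n)%N) (t2 : (2 <= t)%N).
Implicit Types S A B : {set 'I_n}.

(* [lam] optimises, up to constants, the exponent
   - lam |S| t^2 / (4 n) + 4 lam^2 t |S|, whose value is then - a |S|. *)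
Let a : R := t%:R ^+ 3 / (256 * n%:R ^+ 2).
Let lam : R := t%:R / (32 * n%:R).

Definition balanced S A B :=
  [&& A \subset S, B \subset S, [disjoint A & B], #|A| == t, #|B| == t
    & (\sum_(i in B) i + t ^ 2 <= \sum_(i in A) i)%N].

(** If all degrees on [A] and [B] agree, the exponential is [exp 0 = 1], so this bounds the
    probability of that event. *)
Lemma balanced_mgf S A B : balanced S A B ->
  \sum_w weight (@prob n R) w *
      expR (\sum_e (- lam * coef R S A B e) * (w e)%:R) <= expR (- a) ^+ #|S|.
Proof.
case/and5P => AS BS AB /eqP cA /andP[/eqP cB gap].
have nR : 0 < n%:R :> R by rewrite ltr0n.
have tn : (t <= n)%N by rewrite -cA -[leqRHS]card_ord max_card.
have tS : (2 * t <= #|S|)%N.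
  rewrite mul2n -addnn -{1}cA -cB.
  have := AB; rewrite -(leq_card_setU A B).2 => /eqP <-.
  by apply: subset_leq_card; rewrite finset.subUset AS BS.
have lam0 : 0 <= lam by rewrite divr_ge0 ?mulr_ge0.
(* As [|coef| <= 2], this keeps the exponents within the range of [weight_mgf]. *)
have lam4 : lam <= 4^-1.
  rewrite ler_pdivrMr; last by rewrite mulr_gt0.
  have : t%:R <= n%:R :> R by rewrite ler_nat.
  by lra.
apply: (le_trans (weight_mgf _ _)) => [e|e|]; first exact: prob01.
  rewrite normrM normrN (ger0_norm lam0).
  apply: le_trans (ler_pM lam0 _ lam4 (normr_coef R S A B e)) _ => //.
  by lra.
rewrite -expRM_natl ler_expR.
under eq_bigr do rewrite -mulrA.
rewrite -mulr_sumr.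
under [X in _ + X]eq_bigr do rewrite exprMn.
rewrite -mulr_sumr sqrrN.
(* This gives [|S| - 2 >= |S| / 2], so the expected gap dominates the quadratic term. *)
have S4 : (4 <= #|S|)%N by apply: leq_trans tS; lia.
have P := @sum_coef_prob n R S A B t AS BS cA cB gap (leq_trans _ S4).
have {}P := P isT; have Q := @sum_coef_sqr n R S A B t AB cA cB.
have lam20 := sqr_ge0 lam.
have {P} := ler_wpM2l lam0 P; have {Q} := ler_wpM2l lam20 Q.
rewrite !natrM natrB ?(leq_trans _ S4) // => Q P.
have S4R : 4 <= #|S|%:R :> R by rewrite ler_nat.
pose z : R := t%:R ^+ 3 / n%:R ^+ 2.
have z0 : 0 <= z by rewrite divr_ge0 ?exprn_ge0.
have nN : n%:R != 0 :> R by rewrite gt_eqF.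
have aE : a = z / 256 by rewrite /a /z; field.
have PE : lam * ((#|S|%:R - 2%:R) * (t%:R * t%:R) / (2%:R * n%:R)) =
    z * (#|S|%:R - 2) / 64 by rewrite /lam /z; field.
have QE : lam ^+ 2 * (4%:R * t%:R * #|S|%:R) = z * #|S|%:R / 256.
  by rewrite /lam /z; field.
rewrite {}PE in P; rewrite {}QE in Q; rewrite {}aE.
rewrite mulNr; apply: le_trans (_ : - (z * (#|S|%:R - 2) / 64) + z * #|S|%:R / 256 <= _).
  by rewrite lerD // lerN2.
by nra.
Qed.

Hypothesis an : 16 * n%:R <= expR a.

(** Each [S] has at most [4^|S|] pairs [A], [B], and [S] is nonempty, so the sum is at most
    [(1 + 4 q)^n - 1] with [q = exp (- a) <= 1 / (16 n)]; and [exp (1/4) < 2]. *)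
Lemma sum_balanced_lt1 :
  \sum_S \sum_A \sum_(B | balanced S A B) expR (- a) ^+ #|S| < 1.
Proof.
have nR : 0 < n%:R :> R by rewrite ltr0n.
set q := expR (- a).
have q0 : 0 <= q by apply: expR_ge0.
have qn : q * (16 * n%:R) <= 1.
  by rewrite /q expRN mulrC ler_pdivrMr ?expR_gt0 // mul1r.
have qx : (1 + 4 * q) ^+ n < 2.
  apply: le_lt_trans (_ : expR (4^-1) < 2); last first.
    by apply: le_lt_trans (expR_le_quad _) _; lra.
  apply: le_trans (_ : expR (4 * q) ^+ n <= _).
    by rewrite lerXn2r ?nnegrE ?expR_ge0 ?expR_ge1Dx // addr_ge0 ?mulr_ge0.
  by rewrite -expRM_natl ler_expR; nra.
have E : \sum_(S : {set 'I_n}) (4 * q) ^+ #|S| = (1 + 4 * q) ^+ n.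
  rewrite -[in RHS](card_ord n) -prodr_const addrC bigA_distr.
  apply: eq_bigr => S _; rewrite -big_mkcond /= prodr_const //.
move: E; rewrite (bigD1 (finset.set0 : {set 'I_n})) //= cards0 expr0 => E.
suff : \sum_S \sum_A \sum_(B | balanced S A B) q ^+ #|S| <=
   \sum_(S : {set 'I_n} | S != finset.set0) (4 * q) ^+ #|S| by lra.
have bS S A B : balanced S A B ->
    [&& S != finset.set0, A \in powerset S & B \in powerset S].
  case/and5P => AS BS _ /eqP cA _; rewrite !powersetE AS BS !andbT.
  apply: contraTneq AS => ->; rewrite finset.subset0 -cards_eq0 cA.
  by rewrite -lt0n (leq_trans _ t2).
rewrite [leRHS]big_mkcond; apply: ler_sum => S _.
have [->|S0] /= := eqVneq S finset.set0.
  rewrite big1 // => A _; rewrite big1 // => B.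
  by move=> /bS; rewrite eqxx.
have qS : 0 <= q ^+ #|S| by apply: exprn_ge0.
apply: le_trans (_ : \sum_(A in powerset S) \sum_(B in powerset S) q ^+ #|S| <= _).
  rewrite [leRHS]big_mkcond; apply: ler_sum => A _.
  case: ifPn => [AS|nAS]; last first.
    by rewrite big1 // => B /bS/and3P[_ AS]; rewrite AS in nAS.
  rewrite big_mkcond [leRHS]big_mkcond; apply: ler_sum => B _.
  by case: ifP => [/bS/and3P[_ _ ->]|_] //; case: ifP.
rewrite !sumr_const !card_powerset -mulrnA.
by rewrite -expnMn -[leLHS]mulr_natl natrX exprMn.
Qed.

(** First moment: if every graph failed, [phi] would be at least 1 everywhere, while its expectation
    is below 1. *)
Lemma exists_small_rep : exists w : {ffun 'I_n * 'I_n -> bool},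
  forall S : {set bitgraph w}, (rep (induced S) < 2 * t)%N.
Proof.
apply: contrapT => noW.
have bad (w : {ffun 'I_n * 'I_n -> bool}) : exists S A B, balanced S A B /\
    \sum_e (- lam * coef R S A B e) * (w e)%:R = 0.
  apply: contrapT => nob; apply: noW; exists w => S.
  have -> : (2 * t = (2 * t).-1.+1)%N by lia.
  rewrite ltnS; apply/rep_inducedP => D; rewrite leqNgt; apply/negP => DT.
  have [|A [B [AT BT AB cA [cB gap]]]] :=
    @sum_gap n t [set v in S | sdeg S v == D]; first exact: leq_trans (leqSpred _) DT.
  have TS : ([set v in S | sdeg S v == D] : {set 'I_n}) \subset (S : {set 'I_n}).
    by apply/fintype.subsetP => v; rewrite inE => /andP[].
  have AS := fintype.subset_trans AT TS.
  have BS := fintype.subset_trans BT TS.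
  apply: nob; exists S, A, B; split.
    by rewrite /balanced AB cA cB !eqxx gap AS BS.
  under eq_bigr do rewrite -mulrA.
  rewrite -mulr_sumr (@sum_coef_adj n R S A B t AS BS cA cB w D) ?mulr0 //.
  move=> v; rewrite inE => /orP[/(fintype.subsetP AT)|/(fintype.subsetP BT)];
    by rewrite inE => /andP[_ /eqP].
pose phi (w : {ffun 'I_n * 'I_n -> bool}) :=
  \sum_S \sum_A \sum_(B | balanced S A B)
  expR (\sum_e (- lam * coef R S A B e) * (w e)%:R).
have phi1 w : 1 <= phi w.
  have [S [A [B [bal E]]]] := bad w.
  rewrite /phi (bigD1 S) //= (bigD1 A) //= (bigD1 B) //= E expR0 -!addrA lerDl.
  by rewrite !addr_ge0 //; do ?[apply: sumr_ge0 => ? _]; rewrite ?expR_ge0.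
have : \sum_w weight (@prob n R) w <= \sum_w weight (@prob n R) w * phi w.
  apply: ler_sum => w _; rewrite ler_peMr ?phi1 //.
  by apply: weight_ge0 => e; apply: prob01.
rewrite sum_weight leNgt; apply/negP; rewrite negbK.
apply: le_lt_trans sum_balanced_lt1.
under eq_bigr do rewrite mulr_sumr.
rewrite exchange_big /=; apply: ler_sum => S _.
under eq_bigr do rewrite mulr_sumr.
rewrite exchange_big /=; apply: ler_sum => A _.
under eq_bigr do rewrite mulr_sumr.
rewrite exchange_big /=; apply: ler_sum => B.
exact: balanced_mgf.
Qed.

End UnionBound.

Local Open Scope classical_set_scope.

(** * Limits of superadditive sequences *)

(** The limit is the supremum of [u (a + 1) / a], so a single extremal graph already bounds it from
    below. *)
Lemma fekete_superadd (R : realType) (u : nat -> nat) (C : nat) :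
  (forall a b, (u a.+1 + u b.+1 <= u (a + b).+1)%N) ->
  (forall a, (u a.+1 <= C * a)%N) ->
  exists l : R, (fun k : nat => (u k)%:R / k%:R : R) @ \oo --> l /\
    forall a, (0 < a)%N -> (u a.+1)%:R / a%:R <= l.
Proof.
move=> uD uC.
pose E : set R := [set (u a.+1)%:R / a%:R | a in [set a | (0 < a)%N]].
have supE : has_sup E.
  split; first by exists ((u 2)%:R / 1%:R); exists 1.
  exists C%:R => _ [a /= a0 <-]; rewrite ler_pdivrMr ?ltr0n //.
  by rewrite -natrM ler_nat.
have leE a : (0 < a)%N -> (u a.+1)%:R / a%:R <= sup E.
  by move=> a0; apply: (ub_le_sup (proj2 supE)); exists a.
exists (sup E); split=> //.
have uM q a r : (q * u a.+1 <= u (q * a + r).+1)%N.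
  elim: q => [|q IHq]; first by rewrite mul0n.
  by rewrite !mulSn -addnA; apply: leq_trans (uD _ _); rewrite leq_add2l.
apply/cvgrPdist_lt => /= e e0.
have e20 : 0 < e / 2 by rewrite divr_gt0.
have [_ [m /= m0 <-] mE] := sup_adherent e20 supE.
pose A : R := (u m.+1)%:R.
suff close k : (2 <= k)%N -> 2 * A / e < k%:R ->
    `|sup E - (u k)%:R / k%:R| < e.
  near=> k; apply: close; first by near: k; exists 2.
  near: k; exists (Num.truncn (2 * A / e)).+1 => // n /= nA.
  by apply: lt_le_trans (truncnS_gt _) _; rewrite ler_nat.
case: k => // k k1 kA.
have kR : 0 < k.+1%:R :> R by rewrite ltr0n.
(* Write [k = q m + r]; then [k + 1 <= (q + 1) m] and [q * u m.+1 <= u k.+1]. The rounding costs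
   only [A / (k + 1)] in the ratio. *)
have km : (k.+1 * u m.+1 <= m * u k.+1 + m * u m.+1)%N.
  have := uM (k %/ m)%N m (k %% m)%N; rewrite -divn_eq.
  have := ltn_ceil k m0; nia.
rewrite ger0_norm; last first.
  rewrite subr_ge0; apply: le_trans (leE k k1).
  by rewrite ler_pM // lef_pV2 ?posrE ?ltr0n // ler_nat.
have mR : 0 < m%:R :> R by rewrite ltr0n.
have {}km : k.+1%:R * A <= m%:R * (u k.+1)%:R + m%:R * A.
  by rewrite -!natrM -natrD ler_nat.
have : A / m%:R - A / k.+1%:R <= (u k.+1)%:R / k.+1%:R.
  rewrite lerBlDr -mulrDl ler_pdivrMr // mulrAC ler_pdivlMr //.
  by rewrite mulrDl; lra.
have : A / k.+1%:R < e / 2.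
  rewrite ltr_pdivrMr // mulrAC ltr_pdivlMr // [A * 2]mulrC [e * _]mulrC.
  by rewrite -ltr_pdivrMr.
move: mE; rewrite -/A.
by move: (A / m%:R) (A / k.+1%:R) (_ / k.+1%:R) (sup E) => x y z w; lra.
Unshelve. all: by end_near.
Qed.

(** * Choice of parameters and conclusion *)

Lemma g_ge (R : realType) (d t : nat) : (0 < d)%N -> (2 <= t)%N ->
  16 * d%:R <= expR (t%:R ^+ 3 / (256 * d%:R ^+ 2) : R) ->
  (d <= g (2 * t) d)%N.
Proof.
move=> d0 t2 /(exists_small_rep d0 t2)[w ws].
rewrite -{1}(card_ord d).
apply: (@card_le_threshold rep d (ex_rep_forces^~ d) (2 * t) (bitgraph w)).
by split; first exact: maxdeg_bitgraph.
Qed.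

(** With [y = (d / ln d)^(1/3)], take [t] just above [11 d / y]. Then
    [t^3 >= 1331 d^2 ln d >= 5 * 256 d^2 ln d], so the exponential is at least [d^5 >= 16 d]. *)
Lemma spread_size (R : realType) (d : nat) : (2 <= d)%N ->
  exists t : nat, [/\ (2 <= t)%N,
    16 * d%:R <= expR (t%:R ^+ 3 / (256 * d%:R ^+ 2) : R) &
    44^-1 * (d%:R / ln d%:R) `^ (3^-1) <= d%:R / (2 * t)%:R :> R].
Proof.
move=> d2; have dR : 2 <= d%:R :> R by rewrite ler_nat.
have d0 : 0 < d%:R :> R by lra.
have lnd : 2^-1 <= ln d%:R :> R.
  have := expR_ge1Dx (- ln d%:R : R); rewrite expRN lnK ?posrE //.
  have : d%:R^-1 <= 2^-1 :> R by rewrite lef_pV2 ?posrE.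
  by lra.
have lnd0 : 0 < ln d%:R :> R by lra.
set y := _ `^ _.
have y0 : 0 < y by rewrite powR_gt0 // divr_gt0.
have y3 : y ^+ 3 = d%:R / ln d%:R.
  rewrite -powR_mulrn ?ltW // -powRrM mulVf // powRr1 //.
  by rewrite divr_ge0 // ltW.
(* Thus [11 d / y >= 1], and rounding up at most doubles it: [t <= 22 d / y], whence the constant
   [1/44]. *)
have yd : y <= 11 * d%:R.
  rewrite leNgt; apply/negP => dy.
  have : (11 * d%:R) ^+ 3 < y ^+ 3 by rewrite ltrXn2r // ?nnegrE ?mulr_ge0 // ltW.
  rewrite y3 ltr_pdivlMr // => h.
  have : (11 * d%:R) ^+ 3 * 2^-1 <= (11 * d%:R) ^+ 3 * ln d%:R :> R.
    by rewrite ler_wpM2l // exprn_ge0 // mulr_ge0.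
  have : 0 <= d%:R * (d%:R ^+ 2 - 2) :> R by rewrite mulr_ge0 //; nra.
  nra.
have x1 : 1 <= 11 * d%:R / y by rewrite ler_pdivlMr // mul1r.
have x0 : 0 <= 11 * d%:R / y by lra.
have /andP[tlo thi] := truncn_itv x0.
set t := (Num.truncn (11 * d%:R / y)).+1.
have t1 : 11 * d%:R / y < t%:R by [].
have t2 : t%:R <= 22 * d%:R / y.
  rewrite /t -natr1; apply: le_trans (lerD tlo x1) _.
  by rewrite -mulrDl ler_wpM2r ?invr_ge0 ?(ltW y0) //; lra.
have t0 : 0 < t%:R :> R by lra.
exists t; split.
- by rewrite -(ltr_nat R); lra.
- apply: (@le_trans _ _ (expR (5%:R * ln d%:R))).
    rewrite expRM_natl lnK ?posrE //.
    have d4 : 16 <= d%:R ^+ 4 :> R.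
      have -> : 16 = 2 ^+ 4 :> R by ring.
      by rewrite lerXn2r ?nnegrE.
    by rewrite exprSr ler_wpM2r // ltW.
  rewrite ler_expR ler_pdivlMr; last by rewrite mulr_gt0 // exprn_gt0.
  apply: (@le_trans _ _ ((11 * d%:R / y) ^+ 3)); last first.
    by rewrite lerXn2r ?nnegrE // ltW.
  rewrite expr_div_n y3 invf_div.
  have -> : (11 * d%:R) ^+ 3 * (ln d%:R / d%:R) =
      1331 * (ln d%:R * d%:R ^+ 2) :> R by field; rewrite gt_eqF.
  have : 0 <= ln d%:R * d%:R ^+ 2 :> R by rewrite mulr_ge0 ?exprn_ge0 // ltW.
  nra.
- rewrite ler_pdivlMr; last by rewrite natrM mulr_gt0.
  move: t2; rewrite ler_pdivlMr // natrM => t2.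
  by nra.
Qed.

Theorem theorem2 (R : realType) :
  exists c : R, 0 < c /\
    forall d : nat, (2 <= d)%N ->
      exists lg lh : R,
        [/\ (fun k : nat => (g k d)%:R / k%:R : R) @ \oo --> lg,
            (fun k : nat => (h k d)%:R / k%:R : R) @ \oo --> lh,
            c * (d%:R / ln d%:R) `^ (3^-1) <= lg,
            lg <= lh
          & lh <= d%:R / 2 + 1].
Proof.
exists 44^-1; split; first by rewrite invr_gt0.
move=> d d2.
have hC a : (h a.+1 d <= d.+2 * a)%N by have := h_le a d; lia.
have gC a : (g a.+1 d <= d.+2 * a)%N := leq_trans (g_le_h _ _) (hC a).
have [lg [cg supg]] := fekete_superadd R (u := g^~ d) (g_superadd d) gC.
have [lh [ch suph]] := fekete_superadd R (u := h^~ d) (h_superadd d) hC.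
exists lg, lh; split=> //.
- have [t [t2 /(g_ge (ltnW d2) t2) dg]] := spread_size R d2.
  move=> /le_trans; apply.
  (* The supremum is used at [a = 2 t - 1], where the ratio [g (2 t) d / (2 t - 1)] is at least
     [d / (2 t)]. *)
  have t1 : (0 < (2 * t).-1)%N by lia.
  apply: le_trans (supg _ t1); rewrite prednK; last by lia.
  by rewrite ler_pM // ?ler_nat // lef_pV2 ?posrE ?ltr0n ?ler_nat //; lia.
- apply: (ler_cvg_to cg ch); near=> k.
  by rewrite ler_wpM2r // ler_nat g_le_h.
- apply: (cvgr_to_le ch); near=> k.
  have k0 : (0 < k)%N by near: k; exact: nbhs_infty_gt.
  rewrite ler_pdivrMr ?ltr0n //.
  have : (2 * h k d <= (d + 2) * k)%N.
    rewrite -(prednK k0); apply: leq_trans (h_le _ _) _.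
    by rewrite leq_mul2l leqnSn orbT.
  by rewrite -(ler_nat R) !natrM natrD; lra.
Unshelve. all: by end_near.
Qed.
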